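(* Let $\omega_1,\omega_2\in\mathbb C$ be nonzero with $\omega_1/\omega_2\notin\mathbb R$, and let $\Lambda=\{a\omega_1+b\omega_2: a,b\in\mathbb Z\}$. There is no elliptic function on $\Lambda$ that has exactly one pole, counted with multiplicity, in the fundamental parallelogram $P=\{s\omega_1+t\omega_2: 0\le s<1,\ 0\le t<1\}$.
   Context: A meromorphic function $f$ on $\mathbb C$ is called elliptic on $\Lambda$ if $f(z+\omega_1)=f(z+\omega_2)=f(z)$ for all $z\in\mathbb C$. The set $P$ contains exactly one representative of each class of $\mathbb C$ modulo $\Lambda$. *)

(* Defs.v *)
(* Stdlib reals with Coquelicot's complex numbers. *)
From Stdlib Require Import Reals List.
From Coquelicot Require Import Coquelicot.

Open Scope C_scope.

(* A meromorphic function on the plane is encoded as a total map into the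
   Riemann sphere [option C]: [Some w] is the finite value [w], and [None] is
   the point at infinity, which must be taken exactly at the poles. *)

Definition holomorphic_at (g : C -> C) (z0 : C) : Prop :=
  locally z0 (fun z => ex_derive (K := C_AbsRing) (V := C_NormedModule) g z).

Definition regular_at (f : C -> option C) (z0 : C) : Prop :=
  exists g : C -> C,
    holomorphic_at g z0 /\ locally z0 (fun z => f z = Some (g z)).

(* [f] has a pole of order (multiplicity) [n >= 1] at [z0]: on a punctured
   neighbourhood, f(z) = g(z) / (z - z0)^n with g holomorphic at z0 and
   g(z0) <> 0. *)
Definition pole_of_order (f : C -> option C) (z0 : C) (n : nat) : Prop :=
  (1 <= n)%nat /\ f z0 = None /\
  exists g : C -> C,
    holomorphic_at g z0 /\ g z0 <> 0 /\
    locally' z0 (fun z => f z = Some (g z / (z - z0) ^ n)).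

Definition meromorphic (f : C -> option C) : Prop :=
  forall z0 : C, regular_at f z0 \/ exists n : nat, pole_of_order f z0 n.

Definition lattice (w1 w2 : C) (w : C) : Prop :=
  exists a b : Z, w = RtoC (IZR a) * w1 + RtoC (IZR b) * w2.

(* Periodicity is an equality in the Riemann sphere, so it also makes the set
   of poles periodic. *)
Definition elliptic (w1 w2 : C) (f : C -> option C) : Prop :=
  meromorphic f /\
  forall z : C, f (z + w1) = f z /\ f (z + w2) = f z.

Lemma elliptic_lattice (w1 w2 : C) (f : C -> option C) :
  elliptic w1 w2 f ->
  forall w z : C, lattice w1 w2 w -> f (z + w) = f z.
Proof.
intros [_ Hf] w z [a [b ->]].
assert (H : forall v : C, (forall z, f (z + v) = f z) ->
          forall (k : Z) z, f (z + RtoC (IZR k) * v) = f z).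
{ intros v Hv k; induction k using Z.peano_ind; intros y.
  - f_equal; ring.
  - rewrite <- (IHk y), <- (Hv (y + RtoC (IZR k) * v)); f_equal.
    unfold Z.succ; rewrite plus_IZR, RtoC_plus; ring.
  - rewrite <- (IHk y), <- (Hv (y + RtoC (IZR (Z.pred k)) * v)); f_equal.
    unfold Z.pred; rewrite plus_IZR, RtoC_plus.
    replace (RtoC (-1)) with (- RtoC 1) by (rewrite <- RtoC_opp; reflexivity).
    ring. }
rewrite Cplus_assoc, (H w2), (H w1); auto; intros y; apply Hf.
Qed.

Definition fundamental_parallelogram (w1 w2 : C) (z : C) : Prop :=
  exists s t : R,
    (0 <= s < 1)%R /\ (0 <= t < 1)%R /\ z = RtoC s * w1 + RtoC t * w2.

(* [f] has exactly [N] poles in [A], counted with multiplicity: [l] lists the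
   poles of [f] in [A] without repetition, each paired with its order, and the
   orders add up to [N]. *)
Definition pole_count (f : C -> option C) (A : C -> Prop) (N : nat) : Prop :=
  exists l : list (C * nat),
    NoDup (map fst l) /\
    (forall z n, In (z, n) l <-> A z /\ pole_of_order f z n) /\
    list_sum (map snd l) = N.

(* Main.v *)
Require Import Defs.
From Stdlib Require Import Reals List Lra Lia Classical IndefiniteDescription.
From Coquelicot Require Import Coquelicot.

(** If p is the only pole in P and it is simple, then on the parallelogram
    p + [-1,1] u + [-1,1] v with u = w1/2, v = w2/2 the function, scaled to have
    residue 1 at p, has no other pole.  Subtracting 1/(z - p) leaves a function K
    that is continuous at p and holomorphic elsewhere, so by Goursat its integral
    over the boundary vanishes.  The contributions of f on opposite sides cancel by
    periodicity, hence the integral of dz/(z - p) over the boundary would vanish.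
    But on every side the imaginary part of the integrand has the constant sign of
    the orientation of (u, v), so no exact value (2 pi i) is needed. *)

(** * Bisection of squares *)

Open Scope R_scope.

(* Cousin's lemma for squares: a property that passes from the four quarters to the
   square, and holds for all small squares around each point, holds globally. *)
Lemma square_bisection (T : R -> R -> R -> Prop) :
  (forall a b r, 0 < r -> 0 <= a -> a + r <= 1 -> 0 <= b -> b + r <= 1 ->
     T a b (r / 2) -> T (a + r / 2) b (r / 2) ->
     T a (b + r / 2) (r / 2) -> T (a + r / 2) (b + r / 2) (r / 2) -> T a b r) ->
  (forall x y, 0 <= x <= 1 -> 0 <= y <= 1 ->
     exists d, 0 < d /\
       forall a b r, 0 < r < d -> 0 <= a -> a + r <= 1 -> 0 <= b -> b + r <= 1 ->
         a <= x <= a + r -> b <= y <= b + r -> T a b r) ->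
  T 0 0 1.
Proof.
intros Hsub Hloc.
apply NNPP; intros Hbad.
set (P := fun (n : nat) (q : R * R) =>
  0 <= fst q /\ fst q + / 2 ^ n <= 1 /\ 0 <= snd q /\ snd q + / 2 ^ n <= 1 /\
  ~ T (fst q) (snd q) (/ 2 ^ n)).
assert (Hpos : forall n, 0 < / 2 ^ n).
{ intros n; apply Rinv_0_lt_compat, pow_lt; lra. }
assert (HS : forall n, / 2 ^ S n = / 2 ^ n / 2).
{ intros n; simpl; field; apply pow_nonzero; lra. }
(* A bad square has a bad quarter, since otherwise [Hsub] would make it good. The implication sits
   under the existential so that choice yields a total function [next]. *)
assert (Hstep : forall nq : nat * (R * R), exists q',
  P (fst nq) (snd nq) -> P (S (fst nq)) q' /\
    fst (snd nq) <= fst q' /\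
    fst q' + / 2 ^ S (fst nq) <= fst (snd nq) + / 2 ^ fst nq /\
    snd (snd nq) <= snd q' /\
    snd q' + / 2 ^ S (fst nq) <= snd (snd nq) + / 2 ^ fst nq).
{ intros [n [a b]]; unfold P; cbn [fst snd]; rewrite HS.
  specialize (Hpos n); set (r := / 2 ^ n) in *.
  destruct (classic (T a b (r / 2))) as [H1|H1].
  2: exists (a, b); cbn [fst snd]; intuition lra.
  destruct (classic (T (a + r / 2) b (r / 2))) as [H2|H2].
  2: exists (a + r / 2, b); cbn [fst snd]; intuition lra.
  destruct (classic (T a (b + r / 2) (r / 2))) as [H3|H3].
  2: exists (a, b + r / 2); cbn [fst snd]; intuition lra.
  destruct (classic (T (a + r / 2) (b + r / 2) (r / 2))) as [H4|H4].
  2: exists (a + r / 2, b + r / 2); cbn [fst snd]; intuition lra.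
  exists (a, b); intros (Ha & Ha' & Hb & Hb' & HT); destruct HT; auto. }
apply functional_choice in Hstep; destruct Hstep as [next Hnext].
set (q := fix q n := match n with O => (0, 0) | S n => next (n, q n) end).
assert (HP : forall n, P n (q n)).
{ induction n as [|n IH].
  - unfold P; simpl; rewrite Rinv_1; repeat split; try lra; assumption.
  - exact (proj1 (Hnext (n, q n) IH)). }
assert (Hmono : forall n k,
  fst (q n) <= fst (q (n + k)%nat) /\
  fst (q (n + k)%nat) + / 2 ^ (n + k) <= fst (q n) + / 2 ^ n /\
  snd (q n) <= snd (q (n + k)%nat) /\
  snd (q (n + k)%nat) + / 2 ^ (n + k) <= snd (q n) + / 2 ^ n).
{ intros n; induction k as [|k IH].
  - rewrite Nat.add_0_r; lra.
  - rewrite Nat.add_succ_r.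
    destruct (Hnext (n + k, q (n + k))%nat (HP (n + k)%nat)) as [_ H].
    cbn [fst snd] in H.
    change (q (S (n + k))) with (next (n + k, q (n + k))%nat).
    lra. }
(* Nested intervals: every left end is below every right end, so the supremum of the left ends lies
   in all of them. *)
assert (Hlim : forall c : nat -> R,
  (forall n k, c n <= c (n + k)%nat /\ c (n + k)%nat + / 2 ^ (n + k) <= c n + / 2 ^ n) ->
  exists x, forall n, c n <= x <= c n + / 2 ^ n).
{ intros c Hc.
  assert (Hub : forall m n, c m <= c n + / 2 ^ n).
  { intros m n; destruct (Nat.le_ge_cases m n) as [h|h].
    - destruct (Hc m (n - m)%nat) as [H1 _].
      replace (m + (n - m))%nat with n in H1 by lia.
      specialize (Hpos n); lra.
    - destruct (Hc n (m - n)%nat) as [_ H1].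
      replace (n + (m - n))%nat with m in H1 by lia.
      specialize (Hpos m); lra. }
  destruct (completeness (fun y => exists n, y = c n)) as [x [Hx1 Hx2]].
  - exists (c O + / 2 ^ 0); intros y [m ->]; apply Hub.
  - exists (c O), O; reflexivity.
  - exists x; intros n; split.
    + apply Hx1; exists n; reflexivity.
    + apply Hx2; intros y [m ->]; apply Hub. }
destruct (Hlim (fun n => fst (q n))) as [x Hx].
{ intros n k; specialize (Hmono n k); lra. }
destruct (Hlim (fun n => snd (q n))) as [y Hy].
{ intros n k; specialize (Hmono n k); lra. }
assert (H0 : / 2 ^ 0 = 1) by (simpl; lra).
destruct (Hloc x y) as [d [Hd HT]].
{ specialize (Hx O); rewrite H0 in Hx; simpl in Hx; lra. }
{ specialize (Hy O); rewrite H0 in Hy; simpl in Hy; lra. }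
destruct (pow_lt_1_zero (/ 2)) with (y := d) as [n Hn]; auto.
{ rewrite Rabs_pos_eq; lra. }
specialize (Hn n (le_n n)).
rewrite pow_inv, Rabs_pos_eq in Hn; [|specialize (Hpos n); lra].
destruct (HP n) as (Ha & Ha' & Hb & Hb' & Hbad').
apply Hbad', HT; auto.
Qed.

(** * Neighbourhoods, continuity and complex derivatives in terms of the modulus *)

Open Scope C_scope.

(** [C] carries the product uniformity and the one of its modulus; they have the same
    neighbourhoods, so [Cmod] balls describe the product filter. *)
Lemma locally_Cmod (z : C) (P : C -> Prop) :
  locally (T := C_UniformSpace) z P <->
  exists d : R, (0 < d)%R /\ forall y : C, (Cmod (y - z) < d)%R -> P y.
Proof.
rewrite locally_C; split.
- intros [d Hd]; exists d; split; [apply cond_pos | exact Hd].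
- intros [d [Hd H]]; exists (mkposreal d Hd); exact H.
Qed.

Lemma continuous_Cmod (f : C -> C) (z : C) :
  continuous (T := C_UniformSpace) (U := C_UniformSpace) f z <->
  forall eps : R, (0 < eps)%R ->
    locally (T := C_UniformSpace) z (fun y => (Cmod (f y - f z) < eps)%R).
Proof.
unfold continuous; split.
- intros H eps Heps; apply (H (fun w => (Cmod (w - f z) < eps)%R)).
  apply locally_Cmod; exists eps; auto.
- intros H P HP; apply locally_Cmod in HP; destruct HP as [d [Hd HP]].
  unfold filtermap; generalize (H d Hd).
  apply (filter_imp (F := locally (T := C_UniformSpace) z)); intros y; apply HP.
Qed.

Lemma ex_derive_Cmod (f : C -> C) (z : C) :
  ex_derive (K := C_AbsRing) (V := C_NormedModule) f z <->
  exists l : C, forall eps : R, (0 < eps)%R ->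
    locally (T := C_UniformSpace) z
      (fun y => (Cmod (f y - f z - (y - z) * l) <= eps * Cmod (y - z))%R).
Proof.
split; intros [l Hl]; exists l.
- destruct Hl as [_ Hl]; intros eps Heps.
  specialize (Hl z (fun P h => h) (mkposreal eps Heps)).
  apply locally_C; exact Hl.
- split.
  + apply (is_linear_scal_l (K := C_AbsRing) (V := C_NormedModule)).
  + intros x Hx eps.
    apply (is_filter_lim_locally_unique (V := AbsRing_NormedModule C_AbsRing)) in Hx.
    rewrite <- Hx.
    apply locally_C; exact (Hl eps (cond_pos eps)).
Qed.

Lemma ex_derive_C_continuous (f : C -> C) (z : C) :
  ex_derive (K := C_AbsRing) (V := C_NormedModule) f z ->
  continuous (T := C_UniformSpace) (U := C_UniformSpace) f z.
Proof.
intros H; apply ex_derive_continuous in H.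
intros P HP; apply locally_C; exact (H P HP).
Qed.

Notation continuous_C := (continuous (T := C_UniformSpace) (U := C_UniformSpace)).
Notation ex_derive_C := (ex_derive (K := C_AbsRing) (V := C_NormedModule)).
Notation RInt_C := (RInt (V := C_R_CompleteNormedModule)).
Notation ex_RInt_C := (ex_RInt (V := C_R_NormedModule)).

(** * Integrals along segments *)

Lemma continuous_line (a d : C) (s : R) :
  continuous (U := C_UniformSpace) (fun s : R => a + s * d) s.
Proof.
apply (continuous_plus (V := C_R_NormedModule)).
- apply continuous_const.
- apply (continuous_ext (fun s : R => scal (V := C_R_NormedModule) s d)).
  + intros x; apply scal_R_Cmult.
  + apply (continuous_scal_l (V := C_R_NormedModule)), continuous_id.
Qed.

Lemma continuous_C_mult_r (f : C -> C) (c z : C) :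
  continuous_C f z -> continuous_C (fun y => f y * c) z.
Proof.
rewrite !continuous_Cmod; intros H eps Heps.
assert (Hc := Cmod_ge_0 c).
(* The [+ 1] keeps the divisor positive when [c] is zero. *)
assert (He : (0 < eps / (Cmod c + 1))%R) by (apply Rdiv_lt_0_compat; lra).
generalize (H _ He).
apply (filter_imp (F := locally (T := C_UniformSpace) z)); intros y Hy.
replace (f y * c - f z * c) with ((f y - f z) * c) by ring.
rewrite Cmod_mult.
apply (Rmult_lt_compat_r (Cmod c + 1)) in Hy; [|lra].
unfold Rdiv in Hy; rewrite Rmult_assoc, Rinv_l, Rmult_1_r in Hy by lra.
assert (Hf := Cmod_ge_0 (f y - f z)); lra.
Qed.

Definition segment (a d z : C) : Prop :=
  exists s : R, (0 <= s <= 1)%R /\ z = a + s * d.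

(** The contour integral of [f] along the oriented segment from [a] to [a + d]. *)
Definition segment_int (f : C -> C) (a d : C) : C :=
  RInt_C (fun s : R => f (a + s * d) * d) 0 1.

Lemma continuous_segment (f : C -> C) (a d : C) (s : R) :
  continuous_C f (a + s * d) ->
  continuous (U := C_R_CompleteNormedModule) (fun s : R => f (a + s * d) * d) s.
Proof.
intros H.
apply (continuous_comp (U := R_UniformSpace) (V := C_UniformSpace) (W := C_UniformSpace)
  (fun s : R => a + s * d) (fun z => f z * d)).
- apply continuous_line.
- apply continuous_C_mult_r, H.
Qed.

Lemma ex_RInt_segment (f : C -> C) (a d : C) :
  (forall z, segment a d z -> continuous_C f z) ->
  ex_RInt_C (fun s : R => f (a + s * d) * d) 0 1.
Proof.
intros H; apply (ex_RInt_continuous (V := C_R_CompleteNormedModule)).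
rewrite Rmin_left, Rmax_right by lra.
intros s Hs; apply continuous_segment, H; exists s; auto.
Qed.

(** Opposite sides of a parallelogram share their direction, so their contributions merge into one
    integral that can be estimated pointwise. *)
Lemma is_RInt_segment_minus (f g : C -> C) (a a' d : C) :
  (forall z, segment a d z -> continuous_C f z) ->
  (forall z, segment a' d z -> continuous_C g z) ->
  is_RInt (V := C_R_NormedModule)
    (fun s : R => (f (a + s * d) - g (a' + s * d)) * d) 0 1
    (segment_int f a d - segment_int g a' d).
Proof.
intros Hf Hg.
apply (is_RInt_ext (V := C_R_NormedModule)
  (fun s : R => minus (G := C_R_NormedModule) (f (a + s * d) * d) (g (a' + s * d) * d))).
- intros s _.
  change (f (a + s * d) * d - g (a' + s * d) * d = (f (a + s * d) - g (a' + s * d)) * d).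
  ring.
- apply (is_RInt_minus (V := C_R_NormedModule));
    apply (RInt_correct (V := C_R_CompleteNormedModule)), ex_RInt_segment; assumption.
Qed.

Lemma segment_int_halve (f : C -> C) (a d : C) :
  (forall z, segment a d z -> continuous_C f z) ->
  segment_int f a d = segment_int f a (d / 2) + segment_int f (a + d / 2) (d / 2).
Proof.
intros Hf; unfold segment_int.
assert (Hex : forall x y : R, (0 <= x <= y)%R -> (y <= 1)%R ->
  ex_RInt_C (fun s : R => f (a + s * d) * d) x y).
{ intros x y Hx Hy; apply (ex_RInt_continuous (V := C_R_CompleteNormedModule)).
  rewrite Rmin_left, Rmax_right by lra.
  intros s Hs; apply continuous_segment, Hf; exists s; split; [lra|auto]. }
rewrite <- (RInt_Chasles (V := C_R_CompleteNormedModule) _ 0 (/ 2) 1); [|apply Hex; lra ..].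
(* The substitution [s / 2 + v] maps the unit interval onto either half, for [v] equal to 0 or
   1/2. *)
assert (Hcomp : forall v : R, (0 <= v <= / 2)%R ->
  RInt_C (fun s : R => f (a + s * d) * d) v (v + / 2) =
  RInt_C (fun s : R => f (a + v * d + s * (d / 2)) * (d / 2)) 0 1).
{ intros v Hv.
  assert (H := RInt_comp_lin (V := C_R_CompleteNormedModule)
    (fun s : R => f (a + s * d) * d) (/ 2) v 0 1).
  replace (/ 2 * 0 + v)%R with v in H by ring.
  replace (/ 2 * 1 + v)%R with (v + / 2)%R in H by ring.
  rewrite <- H by (apply Hex; lra).
  apply (RInt_ext (V := C_R_CompleteNormedModule)); intros s _.
  assert (Hs : RtoC (/ 2 * s + v) = s / 2 + v).
  { rewrite RtoC_plus, RtoC_mult, RtoC_inv by lra; field. }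
  etransitivity; [apply scal_R_Cmult|].
  rewrite Hs, RtoC_inv by lra.
  replace (a + (s / 2 + v) * d) with (a + v * d + s * (d / 2)) by field.
  set (w := f _); change ((/ RtoC 2) * (w * d) = w * (d / 2)); field. }
apply f_equal2.
- replace (/ 2)%R with (0 + / 2)%R at 1 by ring.
  rewrite (Hcomp 0%R) by lra.
  replace (a + 0 * d) with a by ring; reflexivity.
- replace 1%R with (/ 2 + / 2)%R at 1 by field.
  rewrite (Hcomp (/ 2)%R) by lra.
  replace (a + RtoC (/ 2) * d) with (a + d / 2); [reflexivity|].
  rewrite RtoC_inv by lra; field.
Qed.

(** [k] stands for the predicted constant difference of the integrands, which integrates to [k * d];
    only the error is bounded. *)
Lemma segment_int_diff_bound (f g : C -> C) (a a' d k : C) (M : R) :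
  (forall z, segment a d z -> continuous_C f z) ->
  (forall z, segment a' d z -> continuous_C g z) ->
  (forall s : R, (0 <= s <= 1)%R ->
     (Cmod (f (a + s * d) - g (a' + s * d) - k)%C <= M)%R) ->
  (Cmod (segment_int f a d - segment_int g a' d - k * d) <= M * Cmod d)%R.
Proof.
intros Hf Hg HM.
assert (Hk : is_RInt (V := C_R_NormedModule) (fun _ => k * d) 0 1 (k * d)).
{ refine (eq_ind _ _ (is_RInt_const (V := C_R_NormedModule) 0 1 (k * d)) _ _).
  etransitivity; [apply scal_R_Cmult|].
  rewrite Rminus_0_r; apply Cmult_1_l. }
assert (H := is_RInt_minus (V := C_R_NormedModule) _ _ _ _ _ _
  (is_RInt_segment_minus f g a a' d Hf Hg) Hk).
apply (norm_RInt_le_const (V := C_R_NormedModule) _ _ _ _ (M * Cmod d)) in H.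
- rewrite Rminus_0_r, Rmult_1_l in H.
  etransitivity; [right; apply Cmod_norm | exact H].
- lra.
- intros s Hs.
  assert (E := Cmod_norm ((f (a + s * d) - g (a' + s * d)) * d - k * d)%C).
  etransitivity; [right; symmetry; exact E|].
  replace ((f (a + s * d) - g (a' + s * d)) * d - k * d)%C
    with ((f (a + s * d) - g (a' + s * d) - k) * d)%C by ring.
  rewrite Cmod_mult.
  apply Rmult_le_compat_r; [apply Cmod_ge_0 | auto].
Qed.

(** * Boundary integrals of parallelograms and Goursat's lemma *)

Definition parallelogram (c u v z : C) : Prop :=
  exists s t : R, (0 <= s <= 1)%R /\ (0 <= t <= 1)%R /\ z = c + s * u + t * v.

Lemma segment_parallelogram (c u v z : C) :
  segment c u z \/ segment (c + v) u z \/ segment c v z \/ segment (c + u) v z ->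
  parallelogram c u v z.
Proof.
intros [[s [Hs ->]]|[[s [Hs ->]]|[[s [Hs ->]]|[s [Hs ->]]]]];
  [exists s, 0%R|exists s, 1%R|exists 0%R, s|exists 1%R, s];
  (split; [lra|split; [lra|ring]]).
Qed.

Lemma sub_parallelogram (c u v z : C) (a b r : R) :
  (0 <= r)%R -> (0 <= a)%R -> (a + r <= 1)%R -> (0 <= b)%R -> (b + r <= 1)%R ->
  parallelogram (c + a * u + b * v) (r * u) (r * v) z -> parallelogram c u v z.
Proof.
intros Hr Ha Ha' Hb Hb' (s & t & Hs & Ht & ->).
exists (a + s * r)%R, (b + t * r)%R.
rewrite !RtoC_plus, !RtoC_mult.
split; [|split; [|ring]]; nra.
Qed.

(** The contour runs through [c], [c + u], [c + u + v], [c + v] and back; opposite sides are paired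
    so that they can be compared. *)
Definition boundary_int (f : C -> C) (c u v : C) : C :=
  segment_int f c u - segment_int f (c + v) u
  + (segment_int f (c + u) v - segment_int f c v).

(* The affine part of [f] at [z] contributes nothing to the boundary integral. *)
Lemma boundary_int_bound (f : C -> C) (c u v z l : C) (M : R) :
  (forall y, parallelogram c u v y -> continuous_C f y) ->
  (forall y, parallelogram c u v y -> (Cmod (f y - f z - (y - z) * l) <= M)%R) ->
  (Cmod (boundary_int f c u v) <= 2 * M * (Cmod u + Cmod v))%R.
Proof.
intros Hc HM.
(* Between opposite sides the affine part differs by the constants [- (v * l)] and [u * l]; after
   multiplication by the directions [u] and [v] they cancel. The bound doubles because two points
   are compared. *)
assert (H1 := segment_int_diff_bound f f c (c + v) u (- (v * l)) (2 * M)).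
assert (H2 := segment_int_diff_bound f f (c + u) c v (u * l) (2 * M)).
unfold boundary_int.
set (A := segment_int f c u - _) in *; set (B := segment_int f (c + u) v - _) in *.
replace (A + B) with ((A - - (v * l) * u) + (B - u * l * v)) by ring.
eapply Rle_trans; [apply Cmod_triangle|].
rewrite Rmult_plus_distr_l.
assert (Htri : forall y y' k, parallelogram c u v y -> parallelogram c u v y' ->
  k = (y - y') * l -> (Cmod (f y - f y' - k) <= 2 * M)%R).
{ intros y y' k Hy Hy' ->.
  replace (f y - f y' - (y - y') * l) with
    ((f y - f z - (y - z) * l) + - (f y' - f z - (y' - z) * l)) by ring.
  eapply Rle_trans; [apply Cmod_triangle|].
  rewrite Cmod_opp; specialize (HM y Hy) as H; specialize (HM y' Hy') as H'; lra. }
apply Rplus_le_compat; [apply H1 | apply H2].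
1,2,4,5: intros y Hy; apply Hc, segment_parallelogram; auto.
- intros s Hs; apply Htri; [| |ring]; apply segment_parallelogram.
  + left; exists s; auto.
  + right; left; exists s; auto.
- intros s Hs; apply Htri; [| |ring]; apply segment_parallelogram.
  + right; right; right; exists s; auto.
  + right; right; left; exists s; auto.
Qed.

(** Each inner edge belongs to two quarters, which traverse it in opposite directions. *)
Lemma boundary_int_subdivide (f : C -> C) (c u v : C) :
  (forall y, parallelogram c u v y -> continuous_C f y) ->
  boundary_int f c u v =
  boundary_int f c (u / 2) (v / 2) + boundary_int f (c + u / 2) (u / 2) (v / 2)
  + boundary_int f (c + v / 2) (u / 2) (v / 2)
  + boundary_int f (c + u / 2 + v / 2) (u / 2) (v / 2).
Proof.
intros Hc; unfold boundary_int.
rewrite (segment_int_halve f c u), (segment_int_halve f (c + v) u),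
  (segment_int_halve f (c + u) v), (segment_int_halve f c v);
  try (intros y Hy; apply Hc, segment_parallelogram; auto).
replace (c + u / 2 + u / 2) with (c + u) by field.
replace (c + v / 2 + v / 2) with (c + v) by field.
replace (c + u / 2 + v / 2 + u / 2) with (c + u + v / 2) by field.
replace (c + u / 2 + v / 2 + v / 2) with (c + v + u / 2) by field.
replace (c + v / 2 + u / 2) with (c + u / 2 + v / 2) by ring.
ring.
Qed.

(** The bound [eps * r ^ 2] scales like area, so it passes from four quarters to the whole. It holds
    locally because the error of the affine approximation and the perimeter are both of order
    [r]. *)
Lemma goursat (f : C -> C) (c u v : C) :
  (forall y, parallelogram c u v y -> ex_derive_C f y) ->
  boundary_int f c u v = 0.
Proof.
intros Hd.
assert (Hc : forall y, parallelogram c u v y -> continuous_C f y).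
{ intros y Hy; apply ex_derive_C_continuous, Hd, Hy. }
apply Cmod_eq_0, Rle_antisym; [|apply Cmod_ge_0].
apply Rnot_lt_le; intros Hpos.
(* Half the modulus, so that the bound at [r = 1] contradicts its positivity. *)
set (eps := (Cmod (boundary_int f c u v) / 2)%R).
assert (Heps : (0 < eps)%R) by (unfold eps; lra).
assert (HT : (Cmod (boundary_int f (c + 0 * u + 0 * v) (1 * u) (1 * v))%C <= eps * 1 ^ 2)%R).
2:{ replace (c + 0 * u + 0 * v) with c in HT by ring.
    rewrite !Cmult_1_l in HT; unfold eps in HT; lra. }
apply (square_bisection (fun a b r =>
  (Cmod (boundary_int f (c + a * u + b * v) (r * u) (r * v)) <= eps * r ^ 2)%R)).
- intros a b r Hr Ha Ha' Hb Hb' H1 H2 H3 H4.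
  rewrite boundary_int_subdivide.
  2:{ intros y Hy; apply Hc; revert Hy; apply sub_parallelogram; lra. }
  assert (Hh : RtoC (r / 2) = r / 2).
  { rewrite RtoC_div by lra; reflexivity. }
  rewrite !RtoC_plus in *; rewrite Hh in *.
  replace (r * u / 2) with (r / 2 * u) by field.
  replace (r * v / 2) with (r / 2 * v) by field.
  replace (c + a * u + b * v + r / 2 * u) with (c + (a + r / 2) * u + b * v) by ring.
  replace (c + a * u + b * v + r / 2 * v) with (c + a * u + (b + r / 2) * v) by ring.
  replace (c + (a + r / 2) * u + b * v + r / 2 * v)
    with (c + (a + r / 2) * u + (b + r / 2) * v) by ring.
  eapply Rle_trans; [apply Cmod_triangle|].
  eapply Rle_trans; [apply Rplus_le_compat_r, Cmod_triangle|].
  eapply Rle_trans; [apply Rplus_le_compat_r, Rplus_le_compat_r, Cmod_triangle|].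
  nra.
- intros x y Hx Hy.
  destruct (proj1 (ex_derive_Cmod f (c + x * u + y * v))) as [l Hl].
  { apply Hd; exists x, y; auto. }
  set (L := (Cmod u + Cmod v)%R).
  assert (HL : (0 <= L)%R).
  { unfold L; generalize (Cmod_ge_0 u), (Cmod_ge_0 v); lra. }
  (* Chosen so that error [eta * (r * L)] and perimeter give [2 * eta * L * L * r ^ 2], at most
     [eps * r ^ 2]. *)
  set (eta := (eps / (2 * (L * L) + 1))%R).
  assert (Heta : (0 < eta)%R) by (unfold eta; apply Rdiv_lt_0_compat; nra).
  assert (HeL : (2 * (eta * (L * L)) <= eps)%R).
  { replace eps with (eta * (2 * (L * L) + 1))%R; [nra|unfold eta; field; nra]. }
  destruct (proj1 (locally_Cmod _ _) (Hl eta Heta)) as [d [Hdp Hl']].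
  (* Points of a cell of side [r] lie within [r * L] of the chosen point, hence within [d]. *)
  exists (d / (L + 1))%R; split; [apply Rdiv_lt_0_compat; lra|].
  intros a b r [Hr Hrd] Ha Ha' Hb Hb' Hax Hby.
  apply Rlt_div_r in Hrd; [|lra].
  eapply Rle_trans; [apply (boundary_int_bound f _ _ _ (c + x * u + y * v) l (eta * (r * L)))|].
  + intros z Hz; apply Hc; revert Hz; apply sub_parallelogram; lra.
  + intros z (s & t & Hs & Ht & ->).
    assert (Hz : (Cmod (c + a * u + b * v + s * (r * u) + t * (r * v) - (c + x * u + y * v))
      <= r * L)%R).
    { replace (c + a * u + b * v + s * (r * u) + t * (r * v) - (c + x * u + y * v))
        with (RtoC (a + s * r - x) * u + RtoC (b + t * r - y) * v).
      2:{ rewrite !RtoC_minus, !RtoC_plus, !RtoC_mult; ring. }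
      eapply Rle_trans; [apply Cmod_triangle|].
      rewrite !Cmod_mult, !Cmod_R; unfold L; rewrite Rmult_plus_distr_l.
      apply Rplus_le_compat; apply Rmult_le_compat_r; try apply Cmod_ge_0;
        apply Rabs_le; nra. }
    eapply Rle_trans; [apply Hl'; nra|].
    apply Rmult_le_compat_l; lra.
  + rewrite !Cmod_mult, !Cmod_R, (Rabs_pos_eq r) by lra.
    fold L; replace (r * Cmod u + r * Cmod v)%R with (r * L)%R by (unfold L; ring).
    assert (0 < r ^ 2)%R by (apply pow_lt; lra).
    replace (2 * (eta * (r * L)) * (r * L))%R with (2 * (eta * (L * L)) * r ^ 2)%R by ring.
    apply Rmult_le_compat_r; lra.
Qed.

(** * Complex derivatives of multiples, translates and a simple fraction *)

Lemma ex_derive_C_scal (f : C -> C) (k z : C) :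
  ex_derive_C f z -> ex_derive_C (fun y => f y * k) z.
Proof.
rewrite !ex_derive_Cmod; intros [l Hl]; exists (l * k); intros eps Heps.
assert (Hk := Cmod_ge_0 k).
assert (He : (0 < eps / (Cmod k + 1))%R) by (apply Rdiv_lt_0_compat; lra).
generalize (Hl _ He).
apply (filter_imp (F := locally (T := C_UniformSpace) z)); intros y Hy.
replace (f y * k - f z * k - (y - z) * (l * k)) with ((f y - f z - (y - z) * l) * k) by ring.
rewrite Cmod_mult.
apply (Rmult_le_compat_r (Cmod k + 1)) in Hy; [|lra].
replace (eps / (Cmod k + 1) * Cmod (y - z) * (Cmod k + 1))%R
  with (eps * Cmod (y - z))%R in Hy by (field; lra).
assert (H := Cmod_ge_0 (f y - f z - (y - z) * l)); lra.
Qed.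

Lemma ex_derive_C_shift (f : C -> C) (w z : C) :
  ex_derive_C f (z + w) -> ex_derive_C (fun y => f (y + w)) z.
Proof.
rewrite !ex_derive_Cmod; intros [l Hl]; exists l; intros eps Heps.
specialize (Hl eps Heps); apply locally_Cmod in Hl; destruct Hl as [d [Hd Hl]].
apply locally_Cmod; exists d; split; [exact Hd|]; intros y Hy.
assert (E : y + w - (z + w) = y - z) by ring.
rewrite <- E in Hy; specialize (Hl _ Hy); rewrite E in Hl; exact Hl.
Qed.

Lemma ex_derive_C_inv (p z : C) :
  z <> p -> ex_derive_C (fun y => / (y - p)) z.
Proof.
intros Hz; apply ex_derive_Cmod; exists (- / ((z - p) * (z - p))); intros eps Heps.
assert (Hzp : z - p <> 0) by (intros H; apply Hz, Ceq_minus, H).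
set (m := Cmod (z - p)).
assert (Hm : (0 < m)%R) by (apply Cmod_gt_0, Hzp).
(* The first radius keeps [Cmod (y - p)] at least [m / 2], so the remainder is at most [2 / m ^ 3]
   times the squared distance to [z]; the second radius absorbs that factor. *)
apply locally_Cmod; exists (Rmin (m / 2) (eps * m ^ 3 / 2)); split.
{ assert (0 < m ^ 3)%R by (apply pow_lt, Hm). apply Rmin_glb_lt; [lra | nra]. }
intros y Hy.
assert (Hy1 := Rlt_le_trans _ _ _ Hy (Rmin_l _ _)).
assert (Hy2 := Rlt_le_trans _ _ _ Hy (Rmin_r _ _)).
assert (Hyp : (m / 2 <= Cmod (y - p))%R).
{ assert (H := Cmod_triangle (y - p) (- (y - z))).
  replace (y - p + - (y - z)) with (z - p) in H by ring.
  rewrite Cmod_opp in H; fold m in H; lra. }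
assert (Hyp0 : y - p <> 0).
{ intros H; rewrite H, Cmod_0 in Hyp; lra. }
replace (/ (y - p) - / (z - p) - (y - z) * - / ((z - p) * (z - p)))
  with ((y - z) * / ((y - p) * ((z - p) * (z - p))) * (y - z)) by (field; auto).
rewrite Cmod_mult; apply Rmult_le_compat_r; [apply Cmod_ge_0|].
rewrite Cmod_mult, Cmod_inv by (repeat apply Cmult_neq_0; assumption).
rewrite !Cmod_mult; fold m.
apply Rle_div_l; [apply Rmult_gt_0_compat; nra|].
apply Rle_trans with (eps * m ^ 3 / 2)%R; [lra|].
replace (eps * m ^ 3 / 2)%R with (eps * (m / 2 * (m * m)))%R by field.
apply Rmult_le_compat_l; [lra|]; apply Rmult_le_compat_r; [nra|exact Hyp].
Qed.

(** * Real independence, and Goursat's lemma with an exceptional corner *)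

Definition R_independent (u v : C) : Prop :=
  forall s t : R, s * u + t * v = 0 -> s = 0%R /\ t = 0%R.

Lemma R_independent_opp_l (u v : C) : R_independent u v -> R_independent (- u) v.
Proof.
intros H s t E; destruct (H (- s)%R t).
- rewrite <- E, RtoC_opp; ring.
- lra.
Qed.

Lemma R_independent_opp_r (u v : C) : R_independent u v -> R_independent u (- v).
Proof.
intros H s t E; destruct (H s (- t)%R).
- rewrite <- E, RtoC_opp; ring.
- lra.
Qed.

(** This is the imaginary part of [u] times the conjugate of [v]. If it vanished, the coordinates
    would be coefficients of linear relations and would all be zero. *)
Lemma R_independent_det (u v : C) :
  R_independent u v -> (snd u * fst v - fst u * snd v <> 0)%R.
Proof.
intros H E; destruct u as [u1 u2], v as [v1 v2]; simpl in E.
destruct (H v1 (- u1)%R) as [Hv1 Hu1].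
{ apply injective_projections; simpl; lra. }
destruct (H v2 (- u2)%R) as [Hv2 Hu2].
{ apply injective_projections; simpl; lra. }
destruct (H 1%R 0%R); [|lra].
apply injective_projections; simpl; nra.
Qed.

(* Halving repeatedly towards [c], the three quarters away from [c] contribute zero by
   [goursat], and the boundary integral of the last one is at most its perimeter. *)
Lemma goursat_corner (f : C -> C) (c u v : C) :
  R_independent u v -> continuous_C f c ->
  (forall y, parallelogram c u v y -> y <> c -> ex_derive_C f y) ->
  boundary_int f c u v = 0.
Proof.
intros Hind Hfc Hd.
assert (Hc : forall y, parallelogram c u v y -> continuous_C f y).
{ intros y Hy; destruct (Ceq_dec y c) as [->|Hyc]; [exact Hfc|].
  apply ex_derive_C_continuous, Hd; assumption. }
(* With [a + b] positive, independence keeps [c] outside the cell, so [goursat] applies. *)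
assert (Hoff : forall a b r : R,
  (0 < r /\ 0 <= a /\ a + r <= 1 /\ 0 <= b /\ b + r <= 1 /\ 0 < a + b)%R ->
  boundary_int f (c + a * u + b * v) (r * u) (r * v) = 0).
{ intros a b r (Hr & Ha & Ha' & Hb & Hb' & Hab); apply goursat; intros y Hy; apply Hd.
  - revert Hy; apply sub_parallelogram; lra.
  - intros ->; destruct Hy as (s & t & Hs & Ht & Hy).
    destruct (Hind (a + s * r)%R (b + t * r)%R) as [H1 H2]; [|nra].
    rewrite !RtoC_plus, !RtoC_mult.
    transitivity (c + a * u + b * v + s * (r * u) + t * (r * v) - c); [ring|].
    rewrite <- Hy; ring. }
assert (Hpos : forall n, (0 < / 2 ^ n <= 1)%R).
{ intros n; split; [apply Rinv_0_lt_compat, pow_lt; lra|].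
  rewrite <- Rinv_1; apply Rinv_le_contravar; [lra | apply pow_R1_Rle; lra]. }
assert (Hscale : forall n, boundary_int f c u v =
  boundary_int f c (RtoC (/ 2 ^ n) * u) (RtoC (/ 2 ^ n) * v)).
{ induction n as [|n IH].
  - simpl; rewrite Rinv_1, !Cmult_1_l; reflexivity.
  - rewrite IH; clear IH.
    assert (HS : (/ 2 ^ n = 2 * / 2 ^ S n)%R).
    { simpl; field; apply pow_nonzero; lra. }
    specialize (Hpos n) as Hn; specialize (Hpos (S n)) as HSn.
    rewrite HS in *; set (r := (/ 2 ^ S n)%R) in *.
    rewrite boundary_int_subdivide.
    2:{ intros y Hy; apply Hc; apply (sub_parallelogram c u v y 0 0 (2 * r)); try lra.
        replace (c + 0 * u + 0 * v) with c by ring; exact Hy. }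
    rewrite RtoC_mult.
    replace (2 * r * u / 2) with (r * u) by field.
    replace (2 * r * v / 2) with (r * v) by field.
    assert (H1 := Hoff r 0%R r); assert (H2 := Hoff 0%R r r); assert (H3 := Hoff r r r).
    replace (c + r * u + 0 * v) with (c + r * u) in H1 by ring.
    replace (c + 0 * u + r * v) with (c + r * v) in H2 by ring.
    rewrite H1, H2, H3 by lra; ring. }
apply Cmod_eq_0, Rle_antisym; [|apply Cmod_ge_0].
apply Rnot_lt_le; intros Hnz.
set (L := (Cmod u + Cmod v)%R).
assert (HL : (0 <= L)%R).
{ unfold L; generalize (Cmod_ge_0 u), (Cmod_ge_0 v); lra. }
destruct (proj1 (locally_Cmod _ _) (proj1 (continuous_Cmod f c) Hfc 1%R Rlt_0_1))
  as [d [Hdp Hball]].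
(* The first term puts the small cell where [f] is within 1 of [f c]; the second makes its perimeter
   smaller than the modulus of the integral. *)
set (eta := Rmin (d / (L + 1)) (Cmod (boundary_int f c u v) / (2 * (L + 1)))).
assert (Heta : (0 < eta)%R).
{ apply Rmin_glb_lt; apply Rdiv_lt_0_compat; lra. }
destruct (pow_lt_1_zero (/ 2)) with (y := eta) as [n Hn]; auto.
{ rewrite Rabs_pos_eq; lra. }
specialize (Hn n (le_n n)); specialize (Hpos n).
rewrite pow_inv, Rabs_pos_eq in Hn by lra.
assert (Hn1 := Rlt_le_trans _ _ _ Hn (Rmin_l _ _)).
assert (Hn2 := Rlt_le_trans _ _ _ Hn (Rmin_r _ _)).
set (r := (/ 2 ^ n)%R) in *.
apply Rlt_div_r in Hn1; [|lra]; apply Rlt_div_r in Hn2; [|lra].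
apply (Rlt_irrefl (Cmod (boundary_int f c u v))).
eapply Rle_lt_trans; [|exact Hn2].
rewrite (Hscale n) at 1; fold r.
eapply Rle_trans; [apply (boundary_int_bound f _ _ _ c 0 1)|].
- intros y Hy; apply Hc, (sub_parallelogram c u v y 0 0 r); try lra.
  replace (c + 0 * u + 0 * v) with c by ring; exact Hy.
- intros y (s & t & Hs & Ht & ->).
  rewrite Cmult_0_r; unfold Cminus at 1; rewrite Copp_0, Cplus_0_r.
  apply Rlt_le, Hball.
  replace (c + s * (r * u) + t * (r * v) - c) with (RtoC (s * r) * u + RtoC (t * r) * v).
  2:{ rewrite !RtoC_mult; ring. }
  eapply Rle_lt_trans; [apply Cmod_triangle|].
  rewrite !Cmod_mult, !Cmod_R, !Rabs_pos_eq by nra.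
  assert (s * r * Cmod u <= r * Cmod u)%R.
  { apply Rmult_le_compat_r; [apply Cmod_ge_0|nra]. }
  assert (t * r * Cmod v <= r * Cmod v)%R.
  { apply Rmult_le_compat_r; [apply Cmod_ge_0|nra]. }
  replace (r * (L + 1))%R with (r * Cmod u + r * Cmod v + r)%R in Hn1 by (unfold L; ring).
  lra.
- rewrite !Cmod_mult, !Cmod_R, !Rabs_pos_eq by lra.
  replace (r * (2 * (L + 1)))%R with (2 * (r * Cmod u + r * Cmod v) + 2 * r)%R by (unfold L; ring).
  lra.
Qed.

(** * Constant sign of the imaginary part along a side *)

(** As [x] is real, adding [x * u] to [v] does not change the determinant [D], so the imaginary part
    of the quotient is [D / Cmod (v + x * u) ^ 2]. Multiplying by [D] treats both orientations at
    once. *)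
Lemma Im_quotient_bound (u v : C) (x : R) :
  (Rabs x <= 1)%R -> v + x * u <> 0 ->
  let D := (snd u * fst v - fst u * snd v)%R in
  (D ^ 2 / (Cmod u + Cmod v) ^ 2 <= D * snd (u / (v + x * u))%C)%R.
Proof.
intros Hx Hnz D.
assert (Hm := proj1 (Cmod_gt_0 _) Hnz).
assert (Hle : (Cmod (v + x * u) <= Cmod u + Cmod v)%R).
{ eapply Rle_trans; [apply Cmod_triangle|].
  rewrite Cmod_mult, Cmod_R, Rplus_comm; apply Rplus_le_compat_r.
  rewrite <- (Rmult_1_l (Cmod u)) at 2; apply Rmult_le_compat_r; [apply Cmod_ge_0|exact Hx]. }
assert (E : (D * snd (u / (v + x * u))%C = D ^ 2 / Cmod (v + x * u) ^ 2)%R).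
{ assert (H : (Cmod (v + x * u) ^ 2 <> 0)%R) by (apply pow_nonzero; lra).
  rewrite Cmod2_alt in *; unfold D; destruct u as [u1 u2], v as [v1 v2].
  unfold Re, Im, Cdiv, Cinv, Cmult, Cplus, RtoC in *; cbn [fst snd] in *.
  field; intros H'; apply H; etransitivity; [|exact H']; ring. }
rewrite E; apply Rmult_le_compat_l; [apply pow2_ge_0|].
apply Rinv_le_contravar; [apply pow_lt, Hm|].
apply pow_incr; lra.
Qed.
Lemma is_RInt_snd_lower (F : R -> C) (I : C) (D M : R) :
  is_RInt (V := C_R_NormedModule) F 0 1 I ->
  (forall s : R, (0 < s < 1)%R -> (M <= D * snd (F s))%R) ->
  (M <= D * snd I)%R.
Proof.
intros H HM.
apply (is_RInt_fct_extend_snd (U := R_NormedModule) (V := R_NormedModule)) in H.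
apply (is_RInt_scal _ _ _ D) in H.
assert (Hc := is_RInt_const 0 1 M).
replace M with (scal (1 - 0)%R M : R) by (rewrite Rminus_0_r; apply Rmult_1_l).
exact (is_RInt_le _ _ 0 1 _ _ Rle_0_1 Hc H HM).
Qed.

(** * A doubly periodic function with one simple pole *)

Ltac on_square a b :=
  exists a, b; split; [apply Rabs_le; lra | split; [apply Rabs_le; lra | rewrite ?RtoC_opp; ring]].

Lemma no_periodic_simple_pole (f g : C -> C) (p u v : C) :
  R_independent u v ->
  (forall z, f (z + 2 * u) = f z) -> (forall z, f (z + 2 * v) = f z) ->
  (forall s t : R, (Rabs s <= 1)%R -> (Rabs t <= 1)%R ->
     p + s * u + t * v <> p -> ex_derive_C f (p + s * u + t * v)) ->
  ex_derive_C g p -> g p = 1 ->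
  ~ locally' (T := C_UniformSpace) p (fun z => f z = g z / (z - p)).
Proof.
intros Hind Hfu Hfv Hfd Hg Hg1 Hfg.
destruct (proj1 (ex_derive_Cmod g p) Hg) as [l Hl].
(* The value [l] is the derivative of [g] at [p], the limit of [(g z - 1) / (z - p)]; it makes [K]
   continuous at [p]. *)
set (K := fun z => if Ceq_dec z p then l else f z - / (z - p)).
assert (HKoff : forall z, z <> p -> K z = f z - / (z - p)).
{ intros z Hz; unfold K; destruct (Ceq_dec z p); [contradiction|reflexivity]. }
assert (HKp : continuous_C K p).
{ apply continuous_Cmod; intros eps Heps.
  assert (He : (0 < eps / 2)%R) by lra.
  generalize (filter_and (F := locally (T := C_UniformSpace) p) _ _ (Hl _ He) Hfg).
  apply (filter_imp (F := locally (T := C_UniformSpace) p)); intros y [Hy Hfy].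
  destruct (Ceq_dec y p) as [->|Hyp].
  { unfold Cminus; rewrite Cplus_opp_r, Cmod_0; exact Heps. }
  assert (Hyp0 : y - p <> 0) by (intros H; apply Hyp, Ceq_minus, H).
  apply (proj1 (Cmod_gt_0 _)) in Hyp0 as Hm.
  rewrite (HKoff y Hyp), (Hfy Hyp).
  replace (K p) with l by (unfold K; destruct (Ceq_dec p p); [reflexivity|contradiction]).
  rewrite Hg1 in Hy.
  replace (g y / (y - p) - / (y - p) - l) with ((g y - 1 - (y - p) * l) / (y - p)) by (field; auto).
  rewrite Cmod_div by exact Hyp0.
  apply Rlt_div_l; [exact Hm|]; nra. }
assert (HKd : forall s t : R, (Rabs s <= 1)%R -> (Rabs t <= 1)%R ->
  p + s * u + t * v <> p -> ex_derive_C K (p + s * u + t * v)).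
{ intros s t Hs Ht; set (z := p + s * u + t * v); intros Hz.
  apply (ex_derive_ext_loc (K := C_AbsRing) (V := C_NormedModule) (fun y => f y - / (y - p))).
  - apply locally_C, locally_Cmod; exists (Cmod (z - p)); split.
    + apply Cmod_gt_0; intros H; apply Hz, Ceq_minus, H.
    + intros y Hy; symmetry; apply HKoff; intros ->.
      rewrite <- Cmod_opp in Hy; replace (- (p - z)) with (z - p) in Hy by ring; lra.
  - apply (ex_derive_minus (K := C_AbsRing) (V := C_NormedModule)).
    + apply Hfd; assumption.
    + apply ex_derive_C_inv, Hz. }
assert (HKc : forall s t : R, (Rabs s <= 1)%R -> (Rabs t <= 1)%R ->
  continuous_C K (p + s * u + t * v)).
{ intros s t Hs Ht; destruct (Ceq_dec (p + s * u + t * v) p) as [->|Hz]; [exact HKp|].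
  apply ex_derive_C_continuous, HKd; assumption. }
(* Cutting at the centre [p] makes it a corner of each of four pieces, one per choice of signs. *)
assert (Hcorner : forall a b : R, (Rabs a = 1)%R -> (Rabs b = 1)%R ->
  R_independent (a * u) (b * v) -> boundary_int K p (a * u) (b * v) = 0).
{ intros a b Ha Hb Hab; apply goursat_corner; [exact Hab|exact HKp|].
  intros y (s & t & Hs & Ht & ->).
  replace (p + s * (a * u) + t * (b * v)) with (p + RtoC (s * a) * u + RtoC (t * b) * v).
  2:{ rewrite !RtoC_mult; ring. }
  apply HKd; rewrite Rabs_mult, ?Ha, ?Hb, Rabs_pos_eq; lra. }
assert (R1 : Rabs 1 = 1%R) by (apply Rabs_pos_eq; lra).
assert (Rm1 : Rabs (Ropp 1) = 1%R) by (rewrite Rabs_Ropp; exact R1).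
assert (E1 : forall w, RtoC 1 * w = w) by (intros; ring).
assert (Em1 : forall w, RtoC (Ropp 1) * w = - w).
{ intros w; rewrite RtoC_opp; ring. }
assert (B1 := Hcorner 1%R 1%R R1 R1).
assert (B2 := Hcorner (Ropp 1) 1%R Rm1 R1).
assert (B3 := Hcorner (Ropp 1) (Ropp 1) Rm1 Rm1).
assert (B4 := Hcorner 1%R (Ropp 1) R1 Rm1).
rewrite ?E1, ?Em1 in B1; rewrite ?E1, ?Em1 in B2.
rewrite ?E1, ?Em1 in B3; rewrite ?E1, ?Em1 in B4.
specialize (B1 Hind); specialize (B2 (R_independent_opp_l _ _ Hind)).
specialize (B3 (R_independent_opp_l _ _ (R_independent_opp_r _ _ Hind))).
specialize (B4 (R_independent_opp_r _ _ Hind)).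
assert (Hcont : forall z, (exists s t : R, (Rabs s <= 1)%R /\ (Rabs t <= 1)%R /\
  z = p + s * u + t * v) -> continuous_C K z).
{ intros z (s & t & Hs & Ht & ->); apply HKc; assumption. }
(* The outer boundary is eight half-sides issuing from the midpoints [p - v], [p + v], [p + u],
   [p - u]; each of the four integrals pairs a half-side with its translate by a period. *)
assert (I1 := is_RInt_segment_minus K K (p - v) (p + v) u).
assert (I2 := is_RInt_segment_minus K K (p + v) (p - v) (- u)).
assert (I3 := is_RInt_segment_minus K K (p + u) (p - u) v).
assert (I4 := is_RInt_segment_minus K K (p - u) (p + u) (- v)).
lapply I1; clear I1; [intros I1; lapply I1; clear I1; [intros I1|]|].
2,3: intros z [s [Hs ->]]; apply Hcont; first [on_square s 1%R | on_square s (Ropp 1)].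
lapply I2; clear I2; [intros I2; lapply I2; clear I2; [intros I2|]|].
2,3: intros z [s [Hs ->]]; apply Hcont; first [on_square (-s)%R 1%R | on_square (-s)%R (Ropp 1)].
lapply I3; clear I3; [intros I3; lapply I3; clear I3; [intros I3|]|].
2,3: intros z [s [Hs ->]]; apply Hcont; first [on_square 1%R s | on_square (Ropp 1) s].
lapply I4; clear I4; [intros I4; lapply I4; clear I4; [intros I4|]|].
2,3: intros z [s [Hs ->]]; apply Hcont; first [on_square 1%R (-s)%R | on_square (Ropp 1) (-s)%R].
set (D := (snd u * fst v - fst u * snd v)%R).
assert (HD : D <> 0%R) by apply R_independent_det, Hind.
set (m := (D ^ 2 / (Cmod u + Cmod v) ^ 2)%R).
assert (Hm : (0 < m)%R).
{ assert (HL : (0 < Cmod u + Cmod v)%R).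
  { assert (Hu0 : u <> 0).
    { intros H; destruct (Hind 1%R 0%R); [rewrite H; ring|lra]. }
    apply Cmod_gt_0 in Hu0; generalize (Cmod_ge_0 v); lra. }
  apply Rdiv_lt_0_compat; [apply pow2_gt_0, HD | apply pow_lt, HL]. }
assert (Hnu : forall s : R, v + s * u <> 0).
{ intros s H; destruct (Hind s 1%R); [rewrite <- H; ring|lra]. }
assert (Hnv : forall s : R, u + s * v <> 0).
{ intros s H; destruct (Hind 1%R s); [rewrite <- H; ring|lra]. }
assert (Hu : forall s : R, (0 < s < 1)%R ->
  (2 * m <= D * snd (u / (v + s * u) + u / (v + (- s)%R * u))%C)%R).
{ intros s Hs.
  assert (H1 := Im_quotient_bound u v s); assert (H2 := Im_quotient_bound u v (- s)).
  cbv zeta in *; fold D in H1, H2; fold m in H1, H2.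
  change (2 * m <= D * (snd (u / (v + s * u))%C + snd (u / (v + (- s)%R * u))%C))%R.
  specialize (H1 ltac:(apply Rabs_le; lra) (Hnu _)).
  specialize (H2 ltac:(apply Rabs_le; lra) (Hnu _)).
  lra. }
assert (Hv : forall s : R, (0 < s < 1)%R ->
  (2 * m <= D * snd (- (v / (u + s * v) + v / (u + (- s)%R * v)))%C)%R).
{ intros s Hs.
  assert (H1 := Im_quotient_bound v u s); assert (H2 := Im_quotient_bound v u (- s)).
  cbv zeta in *.
  (* Exchanging [u] and [v] reverses the orientation; the outer minus sign in [Hv] compensates. *)
  replace (snd v * fst u - fst v * snd u)%R with (- D)%R in * by (unfold D; ring).
  rewrite (Rplus_comm (Cmod v)) in *.
  replace ((- D) ^ 2)%R with (D ^ 2)%R in * by ring; fold m in H1, H2.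
  change (2 * m <= D * - (snd (v / (u + s * v))%C + snd (v / (u + (- s)%R * v))%C))%R.
  specialize (H1 ltac:(apply Rabs_le; lra) (Hnv _)).
  specialize (H2 ltac:(apply Rabs_le; lra) (Hnv _)).
  lra. }
(* The values of [f] cancel by periodicity; only the subtracted fraction at [p + w'] and [p - w]
   survives. *)
assert (HKdiff : forall w w' d : C, w <> 0 -> w' <> 0 -> f (p + w') = f (p - w) ->
  (K (p - w) - K (p + w')) * d = d / w' + d / w).
{ intros w w' d Hw Hw' Hf.
  rewrite !HKoff, Hf.
  - replace (p - w - p) with (- w) by ring; replace (p + w' - p) with w' by ring.
    field; auto.
  - intros H; apply Hw'; transitivity (p + w' - p); [ring|rewrite H; ring].
  - intros H; apply Hw; transitivity (p - (p - w)); [ring|rewrite H; ring]. }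
assert (HKu : forall s : R,
  (K (p - (v + (- s)%R * u)) - K (p + (v + s * u))) * u
  = u / (v + s * u) + u / (v + (- s)%R * u)).
{ intros s; apply HKdiff; [apply Hnu | apply Hnu | rewrite <- (Hfv (p - _)); f_equal].
  rewrite RtoC_opp; ring. }
assert (HKv : forall s : R,
  (K (p - (u + (- s)%R * v)) - K (p + (u + s * v))) * v
  = v / (u + s * v) + v / (u + (- s)%R * v)).
{ intros s; apply HKdiff; [apply Hnv | apply Hnv | rewrite <- (Hfu (p - _)); f_equal].
  rewrite RtoC_opp; ring. }
apply (is_RInt_snd_lower _ _ D (2 * m)) in I1.
2:{ intros s Hs; specialize (Hu s Hs); rewrite <- HKu in Hu.
  replace (p - v + s * u) with (p - (v + (- s)%R * u)) by (rewrite RtoC_opp; ring).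
  replace (p + v + s * u) with (p + (v + s * u)) by ring.
  exact Hu. }
apply (is_RInt_snd_lower _ _ D (2 * m)) in I2.
2:{ intros s Hs; specialize (Hu s Hs); rewrite Cplus_comm in Hu.
  (* Direction [- u] replaces [s] by [- s], and its sign offsets the exchanged order of the
     sides. *)
  assert (E := HKu (- s)%R); rewrite Ropp_involutive in E; rewrite <- E in Hu; clear E.
  replace (p + v + s * - u) with (p + (v + (- s)%R * u)) by (rewrite RtoC_opp; ring).
  replace (p - v + s * - u) with (p - (v + s * u)) by ring.
  set (x := K (p + _)) in *; set (y := K (p - _)) in *.
  replace ((x - y) * - u) with ((y - x) * u) by ring; exact Hu. }
apply (is_RInt_snd_lower _ _ D (2 * m)) in I3.
2:{ intros s Hs; specialize (Hv s Hs); rewrite <- HKv in Hv.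
  replace (p - u + s * v) with (p - (u + (- s)%R * v)) by (rewrite RtoC_opp; ring).
  replace (p + u + s * v) with (p + (u + s * v)) by ring.
  set (x := K (p + _)) in *; set (y := K (p - _)) in *.
  replace ((x - y) * v) with (- ((y - x) * v)) by ring; exact Hv. }
apply (is_RInt_snd_lower _ _ D (2 * m)) in I4.
2:{ intros s Hs; specialize (Hv s Hs); rewrite (Cplus_comm (v / _)) in Hv.
  assert (E := HKv (- s)%R); rewrite Ropp_involutive in E; rewrite <- E in Hv; clear E.
  replace (p + u + s * - v) with (p + (u + (- s)%R * v)) by (rewrite RtoC_opp; ring).
  replace (p - u + s * - v) with (p - (u + s * v)) by ring.
  set (x := K (p + _)) in *; set (y := K (p - _)) in *.
  replace ((y - x) * - v) with (- ((y - x) * v)) by ring; exact Hv. }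
(* The four corner parallelograms at [p] tile the big one: the edges through [p]
   cancel and only the outer boundary remains. *)
assert (Hsum : boundary_int K p u v - boundary_int K p (- u) v
  + boundary_int K p (- u) (- v) - boundary_int K p u (- v) = 0).
{ rewrite B1, B2, B3, B4; ring. }
unfold boundary_int in Hsum.
replace (p + - u) with (p - u) in Hsum by ring.
replace (p + - v) with (p - v) in Hsum by ring.
(* The sum of four terms, each at least [2 * m], would be zero. *)
apply (f_equal (fun z => D * snd z)%R) in Hsum.
unfold Cminus, Cplus, Copp, RtoC in *; cbn [fst snd] in *.
lra.
Qed.

(** * Translating poles and extracting the unique pole *)

Lemma Cplus_reg_r (w y z : C) : y + w = z + w -> y = z.
Proof. intros H; transitivity (y + w - w); [ring|rewrite H; ring]. Qed.

Lemma locally_C_shift (w z : C) (P : C -> Prop) :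
  locally (T := C_UniformSpace) (z + w) P ->
  locally (T := C_UniformSpace) z (fun y => P (y + w)).
Proof.
rewrite !locally_Cmod; intros [d [Hd H]]; exists d; split; [exact Hd|].
intros y Hy; apply H; replace (y + w - (z + w)) with (y - z) by ring; exact Hy.
Qed.

Lemma pole_of_order_shift (f : C -> option C) (w z : C) (n : nat) :
  (forall y, f (y + w) = f y) -> pole_of_order f (z + w) n -> pole_of_order f z n.
Proof.
intros Hf (Hn & Hz & g & Hg & Hg0 & Hfg).
split; [exact Hn|split; [rewrite <- Hf; exact Hz|]].
exists (fun y => g (y + w)); split; [|split; [exact Hg0|]].
- generalize (locally_C_shift w z _ Hg).
  apply (filter_imp (F := locally (T := C_UniformSpace) z)); intros y.
  apply ex_derive_C_shift.
- generalize (locally_C_shift w z _ Hfg).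
  apply (filter_imp (F := locally (T := C_UniformSpace) z)); intros y Hy Hyz.
  rewrite <- Hf, Hy.
  + replace (y + w - (z + w)) with (y - z) by ring; reflexivity.
  + intros H; apply Hyz, (Cplus_reg_r w), H.
Qed.

(** Every listed order is at least one, so a total of one leaves a single entry, of order one. *)
Lemma pole_count_1 (f : C -> option C) (A : C -> Prop) :
  pole_count f A 1 ->
  exists p, A p /\ pole_of_order f p 1 /\
    forall z n, A z -> pole_of_order f z n -> z = p.
Proof.
intros (l & _ & Hl & Hsum).
assert (Hpos : forall z n, In (z, n) l -> (1 <= n)%nat).
{ intros z n H; apply Hl in H; apply H. }
destruct l as [|[p n] [|[q m] l]]; simpl in Hsum.
- discriminate.
- replace n with 1%nat in * by lia; exists p.
  split; [|split].
  1,2: apply (Hl p 1%nat); left; reflexivity.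
  intros z k HA Hk.
  destruct (proj2 (Hl z k) (conj HA Hk)) as [E|[]]; inversion E; reflexivity.
- assert (H1 := Hpos p n (or_introl eq_refl)).
  assert (H2 := Hpos q m (or_intror (or_introl eq_refl))); lia.
Qed.

(** * Reduction modulo the lattice and conclusion *)

Lemma R_independent_of_ratio (u v : C) :
  u <> 0 -> v <> 0 -> ~ (exists r : R, u / v = r) -> R_independent u v.
Proof.
intros Hu Hv Hr s t E.
assert (Hs : s = 0%R).
{ apply NNPP; intros Hs; apply Hr; exists (- t / s)%R.
  assert (Hs' : RtoC s <> 0) by (intros H; apply Hs, RtoC_inj, H).
  rewrite RtoC_div, RtoC_opp by exact Hs.
  transitivity ((s * u + t * v - t * v) / (s * v)); [field; auto|].
  rewrite E; field; auto. }
subst s; split; [reflexivity|].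
apply NNPP; intros Ht.
apply (Cmult_neq_0 t v); [intros H; apply Ht, RtoC_inj, H | exact Hv |].
rewrite <- E; ring.
Qed.

Lemma lattice_translate (w1 w2 : C) (s t : R) :
  exists a b : Z, fundamental_parallelogram w1 w2
    (s * w1 + t * w2 - (IZR a * w1 + IZR b * w2)).
Proof.
exists (Int_part s), (Int_part t), (s - IZR (Int_part s))%R, (t - IZR (Int_part t))%R.
destruct (base_Int_part s), (base_Int_part t).
split; [lra|split; [lra|]].
rewrite !RtoC_minus; ring.
Qed.

Lemma IZR_small (a : Z) : (Rabs (IZR a) < 1)%R -> a = 0%Z.
Proof.
intros H; apply Rabs_lt_between in H; destruct H as [H1 H2].
apply lt_IZR in H2; rewrite <- opp_IZR in H1; apply lt_IZR in H1; lia.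
Qed.

Theorem corollary4 :
  forall w1 w2 : C,
    w1 <> RtoC 0 -> w2 <> RtoC 0 ->
    ~ (exists r : R, Cdiv w1 w2 = RtoC r) ->
    ~ (exists f : C -> option C,
         elliptic w1 w2 f /\
         pole_count f (fundamental_parallelogram w1 w2) 1).
Proof.
intros w1 w2 Hw1 Hw2 Hr (f & Hell & Hcount).
assert (Hlat := elliptic_lattice w1 w2 f Hell); destruct Hell as [Hmer Hper].
assert (Hind := R_independent_of_ratio w1 w2 Hw1 Hw2 Hr).
destruct (pole_count_1 _ _ Hcount) as (p & (s0 & t0 & Hs0 & Ht0 & Hp) & Hpole & Huniq).
destruct Hpole as (_ & _ & g & Hg & Hg0 & Hfg).
(* Division by [g p] normalises the residue at [p] to one; the default 0 at poles keeps [F] total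
   and periodic. *)
set (F := fun z => match f z with Some w => w * / g p | None => 0 end).
apply (no_periodic_simple_pole F (fun z => g z * / g p) p (w1 / 2) (w2 / 2)).
- intros s t E; destruct (Hind (s / 2)%R (t / 2)%R) as [H1 H2]; [|lra].
  rewrite !RtoC_div by lra; rewrite <- E; field.
- intros z; replace (2 * (w1 / 2)) with w1 by field.
  unfold F; rewrite (proj1 (Hper z)); reflexivity.
- intros z; replace (2 * (w2 / 2)) with w2 by field.
  unfold F; rewrite (proj2 (Hper z)); reflexivity.
- intros s t Hs Ht; set (z := p + s * (w1 / 2) + t * (w2 / 2)); intros Hzp.
  destruct (Hmer z) as [(h & Hh & Hfh)|[n Hn]].
  + apply (ex_derive_ext_loc (K := C_AbsRing) (V := C_NormedModule) (fun y => h y * / g p)).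
    * apply locally_C; revert Hfh.
      apply (filter_imp (F := locally (T := C_UniformSpace) z)); intros y Hy.
      unfold F; rewrite Hy; reflexivity.
    * apply ex_derive_C_scal, (locally_singleton (T := C_UniformSpace) _ _ Hh).
  + exfalso; apply Hzp.
    (* A pole [z] has a translate in the fundamental parallelogram, which must be [p]. *)
    destruct (lattice_translate w1 w2 (s0 + s / 2) (t0 + t / 2)) as (a & b & Hab).
    rewrite !RtoC_plus, !RtoC_div in Hab by lra.
    replace ((s0 + s / 2) * w1 + (t0 + t / 2) * w2) with z in Hab.
    2:{ unfold z; rewrite Hp; field. }
    set (w := IZR a * w1 + IZR b * w2) in Hab.
    assert (Ezw : z - w = p).
    { apply (Huniq _ n Hab), (pole_of_order_shift f w).
      - intros y; apply Hlat; exists a, b; reflexivity.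
      - replace (z - w + w) with z by ring; exact Hn. }
    (* Independence gives [a = s / 2] and [b = t / 2]: integers of absolute value at most 1/2, hence
       zero, so [z] is [p] itself. *)
    destruct (Hind (s / 2 - IZR a)%R (t / 2 - IZR b)%R) as [Ha Hb].
    { rewrite !RtoC_minus, !RtoC_div by lra.
      transitivity (z - w - p); [unfold z, w; field|rewrite Ezw; ring]. }
    apply Rabs_le_between in Hs; apply Rabs_le_between in Ht.
    assert (Ha0 : a = 0%Z) by (apply IZR_small, Rabs_lt_between; lra).
    assert (Hb0 : b = 0%Z) by (apply IZR_small, Rabs_lt_between; lra).
    rewrite <- Ezw; unfold w; rewrite Ha0, Hb0; ring.
- apply ex_derive_C_scal, (locally_singleton (T := C_UniformSpace) _ _ Hg).
- apply Cinv_r, Hg0.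
- revert Hfg; apply (filter_imp (F := locally (T := C_UniformSpace) p)); intros y Hy Hyp.
  unfold F; rewrite (Hy Hyp), Cpow_1_r.
  field; split; [exact Hg0|]; intros H; apply Hyp, Ceq_minus, H.
Qed.
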